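(* Let $M=\langle W,\mathrm{av},\mathrm{pv},\mathrm{ob},V\rangle$ be a CJ-model with $W=\{a,b,c\}$ (three distinct worlds), and let $A$ be a formula with $\|A\|=\{a\}$ such that $\bigcirc(A\mid\top)$ is true in $M$. Then $\mathrm{ob}$ does not satisfy condition (5): there exist $X,Y,Z\subseteq W$ with $Z\in\mathrm{ob}(X)$, $Y\subseteq X$, $Y\cap Z\neq\emptyset$ and $Z\notin\mathrm{ob}(Y)$.
   Context: A CJ-model is a tuple $M=\langle W,\mathrm{av},\mathrm{pv},\mathrm{ob},V\rangle$ where $W\neq\emptyset$; $V$ is a valuation assigning to each propositional atom a subset of $W$, extended to all formulas in the usual way, and $\|A\|=\{x\in W: x\models A\}$; $\mathrm{av},\mathrm{pv}:W\to\mathcal P(W)$ with $w\in\mathrm{av}(w)\subseteq\mathrm{pv}(w)$ for all $w$; and $\mathrm{ob}:\mathcal P(W)\to\mathcal P(\mathcal P(W))$ satisfies, for all $X,Y,Z\subseteq W$: (1) $\emptyset\notin\mathrm{ob}(X)$; (2) if $Y\cap X=Z\cap X$ then ($Y\in\mathrm{ob}(X)\iff Z\in\mathrm{ob}(X)$); (3) if $Y,Z\in\mathrm{ob}(X)$ then $Y\cap Z\in\mathrm{ob}(X)$; (4) if $X\subseteq Y\subseteq Z$ and $X\in\mathrm{ob}(Y)$ then $(Z\setminus Y)\cup X\in\mathrm{ob}(Z)$. Condition (5) is: for all $X,Y,Z\subseteq W$, if $Z\in\mathrm{ob}(X)$, $Y\subseteq X$ and $Y\cap Z\neq\emptyset$,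 then $Z\in\mathrm{ob}(Y)$. $\top$ is a tautology, $\|\top\|=W$. Truth condition (independent of the world of evaluation): $\bigcirc(B\mid A)$ is true iff $\|B\|\cap\|A\|\neq\emptyset$ and for every $X\subseteq\|A\|$ with $X\cap\|B\|\neq\emptyset$ we have $\|B\|\in\mathrm{ob}(X)$. *)

(* Defs.v *)
From mathcomp Require Import all_boot classical_sets.

Set Implicit Arguments.
Unset Strict Implicit.
Unset Printing Implicit Defensive.

Local Open Scope classical_set_scope.

(* The Carmo-Jones language: besides the Boolean connectives, universal
   necessity, necessity over the actual (av) and potential (pv) versions of the
   world, the corresponding monadic obligations, and the dyadic obligation.
   [CondOb B A] is O(B | A): B is obligatory given A. *)
Inductive formula (Atom : Type) : Type :=
| Var of Atom
| Top
| Neg of formula Atom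
| And of formula Atom & formula Atom
| Or of formula Atom & formula Atom
| Imp of formula Atom & formula Atom
| Box of formula Atom
| BoxA of formula Atom
| BoxP of formula Atom
| ObA of formula Atom
| ObP of formula Atom
| CondOb of formula Atom & formula Atom.

Arguments Top {Atom}.

(* The worlds form the type W itself, so W as a set of worlds is [set: W]. *)
Record CJ_model (Atom W : Type) := CJModel {
  av : W -> set W;
  pv : W -> set W;
  ob : set W -> set (set W);
  V : Atom -> set W;
  W_nonempty : [set: W] !=set0;
  av_refl : forall w, av w w;
  av_sub_pv : forall w, av w `<=` pv w;
  ob_cond1 : forall X, ~ ob X set0;
  ob_cond2 : forall X Y Z, Y `&` X = Z `&` X -> (ob X Y <-> ob X Z);
  ob_cond3 : forall X Y Z, ob X Y -> ob X Z -> ob X (Y `&` Z);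
  ob_cond4 : forall X Y Z, X `<=` Y -> Y `<=` Z -> ob Y X ->
    ob Z ((Z `\` Y) `|` X)
}.

Definition ob_cond5 (W : Type) (ob : set W -> set (set W)) : Prop :=
  forall X Y Z : set W, ob X Z -> Y `<=` X -> Y `&` Z !=set0 -> ob Y Z.

(* The clauses for [ObA] and [ObP] are those of Carmo and Jones: the content is
   obligatory in the context av(w) (resp. pv(w)) and can be violated there. *)
Fixpoint sat (Atom W : Type) (M : CJ_model Atom W) (w : W)
    (F : formula Atom) {struct F} : Prop :=
  match F with
  | Var p => V M p w
  | Top => True
  | Neg A => ~ sat M w A
  | And A B => sat M w A /\ sat M w B
  | Or A B => sat M w A \/ sat M w B
  | Imp A B => sat M w A -> sat M w B
  | Box A => forall x, sat M x A
  | BoxA A => av M w `<=` [set x | sat M x A]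
  | BoxP A => pv M w `<=` [set x | sat M x A]
  | ObA A => ob M (av M w) [set x | sat M x A] /\
             av M w `&` [set x | ~ sat M x A] !=set0
  | ObP A => ob M (pv M w) [set x | sat M x A] /\
             pv M w `&` [set x | ~ sat M x A] !=set0
  | CondOb B A =>
      [set x | sat M x B] `&` [set x | sat M x A] !=set0 /\
      forall X : set W, X `<=` [set x | sat M x A] ->
        X `&` [set x | sat M x B] !=set0 -> ob M X [set x | sat M x B]
  end.

Definition truth_set (Atom W : Type) (M : CJ_model Atom W) (F : formula Atom) :
  set W := [set x | sat M x F].

Definition true_in (Atom W : Type) (M : CJ_model Atom W) (F : formula Atom) :
  Prop := forall w, sat M w F.

(* Main.v *)
Require Import Defs.
From mathcomp Require Import all_boot boolp classical_sets.

Local Open Scope classical_set_scope.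

(** Condition (4) lifts [{a} \in ob {a, b}] and [{a} \in ob {a, c}] to the whole
    set of worlds, giving [W \ {b}] and [W \ {c}] as obligations. Under
    condition (5) both restrict to the context [{b, c}], where their
    intersection is empty, against conditions (1), (2) and (3). *)

Lemma ob_cond5_lift_restrict (Atom W : Type) (M : CJ_model Atom W)
    (a b c : W) :
  ob_cond5 (ob M) -> a <> c -> b <> c -> ob M [set a; b] [set a] ->
  ob M [set b; c] (([set: W] `\` [set a; b]) `|` [set a]).
Proof.
move=> ob5 hac hbc oba; apply: (ob5 [set: W]) => //.
  by apply: ob_cond4 => // x ->; left.
(* Condition (5) requires [{b, c}] to meet the lifted set; [c] does, being outside [{a, b}]. *)
exists c; split; first by right.
by left; split=> // -[/esym|/esym].
Qed.

Lemma not_ob_cond5_of_two_pairs (Atom W : Type) (M : CJ_model Atom W)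
    (a b c : W) :
  a <> b -> a <> c -> b <> c ->
  ob M [set a; b] [set a] -> ob M [set a; c] [set a] -> ~ ob_cond5 (ob M).
Proof.
move=> hab hac hbc obab obac ob5.
have obc := ob_cond5_lift_restrict _ _ _ _ _ _ ob5 hac hbc obab.
(* Exchanging [b] and [c] yields the context [{c, b}], which [setUC] reorders to match [obc]. *)
have := ob_cond5_lift_restrict _ _ _ _ _ _ ob5 hab (nesym hbc) obac.
rewrite setUC => obb.
apply: (@ob_cond1 _ _ M [set b; c]).
(* Condition (2) replaces a set disjoint from the context by [set0]: the set in [obc] omits [b], the
   one in [obb] omits [c]. *)
apply: iffLR (ob_cond3 obb obc); apply: ob_cond2.
rewrite set0I; apply/seteqP; split=> // x [xbc [] xE];
  move: xbc; rewrite {x}xE => -[xb xc].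
- by case: xc => [[_ []]|/esym //]; right.
- by case: xb => [[_ []]|/esym //]; right.
Qed.

Lemma not_ob_cond5P (W : Type) (ob : set W -> set (set W)) :
  ~ ob_cond5 ob ->
  exists X Y Z : set W, [/\ ob X Z, Y `<=` X, Y `&` Z !=set0 & ~ ob Y Z].
Proof.
move=> nob5; apply: contrapT => none; apply: nob5 => X Y Z obXZ YX YZ.
by apply: contrapT => nobYZ; apply: none; exists X, Y, Z.
Qed.

Theorem mainTheorem3 (Atom W : Type) (M : CJ_model Atom W) (a b c : W)
    (hab : a <> b) (hac : a <> c) (hbc : b <> c)
    (hW : [set: W] = [set a; b; c])
    (A : formula Atom) (hA : truth_set M A = [set a])
    (hO : true_in M (CondOb A Top)) :
  ~ ob_cond5 (ob M) /\
  exists X Y Z : set W,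
    [/\ ob M X Z, Y `<=` X, Y `&` Z !=set0 & ~ ob M Y Z].
Proof.
(* Every context lies within the truth set of [Top], and [a] itself witnesses that [X] meets that of
   [A]. The world at which [hO] is read is immaterial. *)
have oba X : X a -> ob M X [set a].
  move=> Xa; rewrite -hA; have [_] := hO a; apply=> //.
  by exists a; split=> //; have : truth_set M A a by rewrite hA.
have nob5 : ~ ob_cond5 (ob M).
  by apply: (not_ob_cond5_of_two_pairs _ _ _ _ _ _ hab hac hbc); apply: oba; left.
by split=> //; apply: not_ob_cond5P.
Qed.
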